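(* Let $N\ge 2$ and let $\Sigma_N=\{x\in\mathbb{R}^N:\Phi_N(x)=0\}$ be the Cayley hypersurface, where $$\Phi_N(x_1,\ldots,x_N)=\sum_{d=1}^N(-1)^d\frac{1}{d}\sum_{\substack{(i_1,\ldots,i_d)\in\{1,2,\ldots,N\}^d\\ i_1+\cdots+i_d=N}}x_{i_1}x_{i_2}\cdots x_{i_d}.$$ Then $\Sigma_N$ admits a transitive Abelian group of affine motions; that is, there is an Abelian subgroup $G$ of the group of invertible affine transformations of $\mathbb{R}^N$ such that every element of $G$ maps $\Sigma_N$ onto itself and $G$ acts transitively on $\Sigma_N$.
   Context: The inner sum in $\Phi_N$ runs over all ordered $d$-tuples of positive integers with sum $N$. For example, $\Phi_3=-x_3+x_1x_2-\frac13x_1^3$. An affine motion of a hypersurface in $\mathbb{R}^N$ is an invertible affine transformation $x\mapsto Ax+b$ of $\mathbb{R}^N$ preserving the hypersurface. *)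

(* Defs.v *)
(* MathComp, with reals and classical sets from MathComp-Analysis. *)
From HB Require Import structures.
From mathcomp Require Import all_boot all_algebra.
From mathcomp Require Import classical_sets reals.
Set Implicit Arguments.
Unset Strict Implicit.
Unset Printing Implicit Defensive.
Import GRing.Theory.
Local Open Scope ring_scope.

(* The pair (A, b) stands for the map x |-> A x + b. *)
Record affine (F : fieldType) (n : nat) := Affine {
  affine_pair : 'M[F]_n * 'cV[F]_n;
  affine_unit : affine_pair.1 \in unitmx
}.

HB.instance Definition _ (F : fieldType) (n : nat) :=
  [isSub for @affine_pair F n].
HB.instance Definition _ (F : fieldType) (n : nat) :=
  [Choice of affine F n by <:].

Definition affine_map (F : fieldType) (n : nat) (g : affine F n)
    (x : 'cV[F]_n) : 'cV[F]_n :=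
  (affine_pair g).1 *m x + (affine_pair g).2.

Coercion affine_map : affine >-> Funclass.

Section AffineGroup.
Variables (F : fieldType) (n : nat).
Implicit Types g h k : affine F n.

Fact affine_one_unit : ((1%:M : 'M[F]_n), (0 : 'cV[F]_n)).1 \in unitmx.
Proof. exact: unitmx1. Qed.

Definition affine_one : affine F n := Affine affine_one_unit.

Fact affine_mul_unit g h :
  ((affine_pair g).1 *m (affine_pair h).1, g (affine_pair h).2).1 \in unitmx.
Proof. by rewrite unitmx_mul !affine_unit. Qed.

Definition affine_mul g h : affine F n := Affine (affine_mul_unit g h).

Fact affine_inv_unit g :
  (invmx (affine_pair g).1,
   - (invmx (affine_pair g).1 *m (affine_pair g).2)).1 \in unitmx.
Proof. by rewrite unitmx_inv affine_unit. Qed.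

Definition affine_inv g : affine F n := Affine (affine_inv_unit g).

Fact affine_mulA : associative affine_mul.
Proof.
move=> g h k; apply: val_inj => /=; rewrite /affine_map /=.
by rewrite mulmxA mulmxDr mulmxA addrA.
Qed.

Fact affine_mul1g : left_id affine_one affine_mul.
Proof.
move=> g; apply: val_inj => /=; rewrite /affine_map /= !mul1mx addr0.
by case: (affine_pair g).
Qed.

Fact affine_mulg1 : right_id affine_one affine_mul.
Proof.
move=> g; apply: val_inj => /=; rewrite /affine_map /= mulmx1 mulmx0 add0r.
by case: (affine_pair g).
Qed.

Fact affine_mulVg : left_inverse affine_one affine_inv affine_mul.
Proof.
move=> g; apply: val_inj => /=; rewrite /affine_map /=.
by rewrite mulVmx ?affine_unit // subrr.
Qed.

Fact affine_mulgV : right_inverse affine_one affine_inv affine_mul.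
Proof.
move=> g; apply: val_inj => /=; rewrite /affine_map /=.
by rewrite mulmxN mulmxA mulmxV ?affine_unit // mul1mx addNr.
Qed.

HB.instance Definition _ := isGroup.Build (affine F n)
  affine_mulA affine_mul1g affine_mulg1 affine_mulVg affine_mulgV.

Lemma affine_map1 (x : 'cV[F]_n) : (1%g : affine F n) x = x.
Proof. by rewrite /affine_map /= mul1mx addr0. Qed.

Lemma affine_mapM g h (x : 'cV[F]_n) : (g * h)%g x = g (h x).
Proof. by rewrite /affine_map /= /affine_map mulmxDr mulmxA addrA. Qed.

Lemma affine_map_inj g h : affine_map g =1 affine_map h -> g = h.
Proof.
move=> gh; apply: val_inj => /=.
have b : (affine_pair g).2 = (affine_pair h).2.
  by have := gh 0; rewrite /affine_map !mulmx0 !add0r.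
suff A : (affine_pair g).1 = (affine_pair h).1.
  by rewrite [LHS]surjective_pairing [RHS]surjective_pairing A b.
apply/matrixP => i j; have := gh (delta_mx j 0).
by rewrite /affine_map b => /addIr; rewrite -!colE => /colP/(_ i); rewrite !mxE.
Qed.

End AffineGroup.

(* Indices are shifted: the ordinal i : 'I_N is the index i.+1 in {1, .., N},
   so x i 0 is the coordinate x_(i.+1). *)
Definition cayley_poly (R : realType) (N : nat) (x : 'cV[R]_N) : R :=
  \sum_(1 <= d < N.+1) (-1) ^+ d * d%:R^-1 *
    \sum_(i : {ffun 'I_d -> 'I_N} | (\sum_(k < d) (i k).+1 == N)%N)
      \prod_(k < d) x (i k) 0.

Definition cayley_hypersurface (R : realType) (N : nat) : set 'cV[R]_N :=
  [set x | cayley_poly x = 0].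

Arguments cayley_hypersurface : clear implicits.

(* Main.v *)
Require Import Defs.
From HB Require Import structures.
From mathcomp Require Import all_boot all_algebra.
From mathcomp Require Import classical_sets reals.
From mathcomp Require Import ring.
Set Implicit Arguments.
Unset Strict Implicit.
Unset Printing Implicit Defensive.
Import GRing.Theory.
Local Open Scope ring_scope.
Local Open Scope classical_set_scope.

(* With u(t) = 1 + x_1 t + .. + x_N t^N, the Cayley polynomial is the
   coefficient of t^N in - log u(t). The logarithm turns the product of
   R[t]/(t^(N+1)) into a sum, so the series u with vanishing t^N-coefficient of
   log u form an abelian multiplicative group, and this group acts on itself
   simply transitively by multiplication, which is affine in x. *)

Section TruncatedLogarithm.
Variable F : numFieldType.
Implicit Types u v : {poly F}.

(** The series of - log u in powers of 1 - u, cut after its N-th term: when u(0) = 1, all omitted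
    terms are divisible by X^(N+1). *)
Definition neg_log (N : nat) u : {poly F} :=
  \sum_(d < N) d.+1%:R^-1 *: (1 - u) ^+ d.+1.

Lemma dvdp_Xn_coef n u i : 'X^n %| u -> (i < n)%N -> u`_i = 0.
Proof. by move=> /dvdpP[w ->] lt_in; rewrite coefMXn lt_in. Qed.

(** Polynomial expressions in u respect congruences: u - v divides each difference of powers of 1 -
    u and 1 - v. *)
Lemma neg_log_dvdB N v u w : w %| u - v -> w %| neg_log N u - neg_log N v.
Proof.
move=> wuv; rewrite /neg_log -sumrB; apply: (big_ind (fun p => w %| p)) => [|p q|i _].
- exact: dvdp0.
- exact: dvdp_add.
- rewrite -scalerBr -mul_polyC dvdp_mull // subrXX dvdp_mulr //.
  by rewrite opprB addrC addrA subrK -opprB dvdpNr.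
Qed.

(** This is (- log u)' = - u'/u cleared of its denominator. By the geometric sum the truncation
    error is exactly u' (1 - u)^N, and X divides 1 - u. *)
Lemma deriv_neg_log N u : u.[0] = 1 ->
  'X^N %| u * (neg_log N u)^`() + u^`().
Proof.
move=> u0.
have -> : (neg_log N u)^`() = - u^`() * \sum_(d < N) (1 - u) ^+ d.
  rewrite /neg_log raddf_sum mulr_sumr; apply: eq_bigr => d _ /=.
  rewrite derivZ deriv_exp derivB derivC sub0r -scaler_nat scalerA.
  by rewrite mulVf ?Num.Theory.pnatr_eq0 // scale1r.
have geom := subrX1 (1 - u) N.
have -> : u * (- u^`() * \sum_(d < N) (1 - u) ^+ d) + u^`()
    = u^`() * (1 + (1 - u - 1) * \sum_(d < N) (1 - u) ^+ d) by ring.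
rewrite -geom addrC subrK dvdp_mull // dvdp_exp2r //.
by rewrite -['X]subr0 dvdp_XsubCl rootE !hornerE u0 subrr.
Qed.

(** Logarithmic derivatives add up modulo X^N; the coefficient at N is then recovered from the
    derivative on dividing by N, in characteristic zero. *)
Lemma neg_log_coefM N u v : u.[0] = 1 -> v.[0] = 1 ->
  (neg_log N (u * v))`_N = (neg_log N u)`_N + (neg_log N v)`_N.
Proof.
move=> u0 v0; have uv0 : (u * v).[0] = 1 by rewrite hornerM u0 v0 mulr1.
case: N => [|n]; first by rewrite /neg_log !big_ord0 coef0 addr0.
set N := n.+1; set L := neg_log N.
have /dvdp_Xn_coef-/(_ n (ltnSn n)) :
    'X^N %| (L (u * v))^`() - ((L u)^`() + (L v)^`()).
  (* The constant coefficient of u v is 1, so multiplying by u v is reversible modulo X^N. *)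
  have /Gauss_dvdpr <- : coprimep 'X^N (u * v).
    by rewrite coprimep_expl // coprimep_sym coprimepX rootE uv0 oner_eq0.
  have -> : u * v * ((L (u * v))^`() - ((L u)^`() + (L v)^`()))
      = (u * v * (L (u * v))^`() + (u * v)^`())
        - v * (u * (L u)^`() + u^`()) - u * (v * (L v)^`() + v^`()).
    by rewrite derivM; ring.
  by rewrite !dvdp_sub ?dvdp_mull ?deriv_neg_log.
rewrite coefB coefD !coef_deriv -mulrnDl -mulrnBl -mulr_natr => /eqP.
rewrite mulf_eq0 Num.Theory.pnatr_eq0 orbF subr_eq0.
by move/eqP.
Qed.

End TruncatedLogarithm.

Section CayleyTranslations.
Variables (R : realType) (N : nat).
Implicit Types (x y z : 'cV[R]_N) (u v : {poly R}).

Definition series x : {poly R} := 1 + \sum_(i < N) x i 0 *: 'X^(i.+1).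

Definition coords u : 'cV[R]_N := \col_i u`_(i.+1).

Lemma coef_series x (i : 'I_N) : (series x)`_i.+1 = x i 0.
Proof.
rewrite /series coefD coef1 add0r coef_sum (bigD1 i) //= coefZ coefXn eqxx mulr1.
rewrite big1 ?addr0 // => j ji.
by rewrite coefZ coefXn eqSS eq_sym val_eqE (negbTE ji) mulr0.
Qed.

Lemma coef0_series x : (series x)`_0 = 1.
Proof.
rewrite /series coefD coef1 coef_sum big1 ?addr0 // => i _.
by rewrite coefZ coefXn mulr0.
Qed.

Lemma series0 x : (series x).[0] = 1.
Proof. by rewrite horner_coef0 coef0_series. Qed.

Lemma coords_dvd u v : 'X^(N.+1) %| u - v -> coords u = coords v.
Proof.
move=> uv; apply/colP => i; rewrite !mxE; apply/eqP; rewrite -subr_eq0 -coefB.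
by rewrite (dvdp_Xn_coef uv) // ltnS.
Qed.

(** [coords] forgets the constant coefficient, which is fixed to 1 here, and the coefficients above
    N, which the modulus ignores. *)
Lemma coordsK u : u.[0] = 1 -> 'X^(N.+1) %| series (coords u) - u.
Proof.
move=> u0; suff -> : series (coords u) = take_poly N.+1 u.
  by rewrite -{2}(poly_take_drop N.+1 u) opprD addrA subrr sub0r dvdpNr dvdp_mull.
apply/polyP => -[|k]; rewrite coef_take_poly.
  by rewrite coef0_series -horner_coef0 u0.
rewrite ltnS; case: ltnP => [kN|Nk]; first by rewrite (coef_series _ (Ordinal kN)) mxE.
rewrite /series coefD coef1 add0r coef_sum big1 // => i _.
by rewrite coefZ coefXn eqSS gtn_eqF ?mulr0 // (leq_trans _ Nk).
Qed.

Lemma cayley_polyE x : cayley_poly x = (neg_log N (series x))`_N.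
Proof.
rewrite /cayley_poly /neg_log big_add1 big_mkord coef_sum.
apply: eq_bigr => d _; rewrite coefZ -(opprB (series x)) [in RHS]exprNn.
(* Distributivity turns the power into a sum over index tuples; the coefficient at N then selects
   the tuples of sum N. *)
have -> : (series x - 1) ^+ d.+1 =
    \sum_(f : {ffun 'I_d.+1 -> 'I_N})
      (\prod_(k < d.+1) x (f k) 0) *: 'X^(\sum_(k < d.+1) (f k).+1).
  rewrite /series addrAC subrr add0r -[in LHS](card_ord d.+1) -prodr_const.
  rewrite bigA_distr_bigA; apply: eq_bigr => f _.
  by rewrite scaler_prod prodrXr.
rewrite -[(-1) ^+ _]/((-1) ^+ d.+1) -polyCN -polyC_exp coefCM coef_sum big_mkcond.
rewrite mulrCA mulrA; congr (_ * _); apply: eq_bigr => f _ /=.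
by rewrite coefZ coefXn eq_sym; case: eqP; rewrite ?mulr1 ?mulr0.
Qed.

(** Multiplication by u on the ideal of X in R[X]/(X^(N+1)), in the basis X, ..., X^N. *)
Definition mul_mx u : 'M[R]_N := \matrix_(i, j) (u * 'X^(j.+1))`_(i.+1).

Lemma mul_mxE u x : mul_mx u *m x = coords (u * (series x - 1)).
Proof.
apply/colP => i; rewrite !mxE /series addrAC subrr add0r mulr_sumr coef_sum.
by apply: eq_bigr => j _; rewrite mxE -scalerAr coefZ mulrC.
Qed.

(** Multiplication never lowers degrees, so the matrix is lower triangular, with the constant
    coefficient 1 on the diagonal. *)
Fact translation_unit x : (mul_mx (series x), x).1 \in unitmx.
Proof.
rewrite /= unitmxE det_trig.
  rewrite big1 ?unitr1 // => i _.
  by rewrite mxE coefMXn ltnn subnn coef0_series.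
by apply/is_trig_mxP => i j ij; rewrite mxE coefMXn ltnS ij.
Qed.

Definition translation x : affine R N := Affine (translation_unit x).

(** In [series y] = 1 + ([series y] - 1), the 1 yields the vector x and the rest the linear part. *)
Lemma translationE x y : translation x y = coords (series x * series y).
Proof.
rewrite /affine_map /= mul_mxE; apply/colP => i.
by rewrite !mxE -(coef_series x i) -coefD mulrBr mulr1 subrK.
Qed.

Lemma series_translation x y :
  'X^(N.+1) %| series (translation x y) - series x * series y.
Proof. by rewrite translationE coordsK // hornerM !series0 mulr1. Qed.

(** Hence [cayley_poly] is a homomorphism to the additive group of R, with the hypersurface as
    kernel. *)
Lemma cayley_translation x y :
  cayley_poly (translation x y) = cayley_poly x + cayley_poly y.
Proof.
rewrite !cayley_polyE -neg_log_coefM ?series0 //.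
apply/eqP; rewrite -subr_eq0 -coefB.
by rewrite (dvdp_Xn_coef (neg_log_dvdB N (series_translation x y))).
Qed.

Lemma translationC x y : translation x y = translation y x.
Proof. by rewrite !translationE mulrC. Qed.

Lemma translationA x y z :
  translation x (translation y z) = translation (translation x y) z.
Proof.
rewrite [LHS]translationE [RHS]translationE; apply: coords_dvd.
(* Both sides are compared with the product of the three series. *)
have -> : series x * series (translation y z) - series (translation x y) * series z
  = series x * (series (translation y z) - series y * series z)
    - series z * (series (translation x y) - series x * series y) by ring.
by rewrite dvdp_sub // dvdp_mull // series_translation.
Qed.

Lemma translation_at0 x : translation x 0 = x.
Proof. by rewrite /affine_map mulmx0 add0r. Qed.

Lemma translation0 : translation 0 = 1%g.
Proof.
by apply: affine_map_inj => x; rewrite translationC translation_at0 affine_map1.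
Qed.

Lemma translationM x y :
  (translation x * translation y)%g = translation (translation x y).
Proof. by apply: affine_map_inj => z; rewrite affine_mapM translationA. Qed.

Lemma translation_trans x y : exists z, translation z x = y.
Proof.
(* By commutativity z has to solve [translation x z = y]; inverting the affine map spares inverting
   a power series. *)
exists ((translation x)^-1%g y).
by rewrite translationC -affine_mapM mulgV affine_map1.
Qed.

(** As [translation x] sends 0 to x, its constant part determines x, which makes membership a
    boolean test. *)
Definition cayley_group : {pred affine R N} :=
  [pred g | (cayley_poly (affine_pair g).2 == 0)
            && (g == translation (affine_pair g).2)].

Lemma cayley_groupP (g : affine R N) :
  reflect (exists2 x, cayley_hypersurface R N x & g = translation x)
          (g \in cayley_group).
Proof.
apply: (iffP andP) => [[/eqP gx /eqP ->]|[x /eqP x0 ->]]; last by rewrite /= x0.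
by exists (affine_pair g).2.
Qed.

End CayleyTranslations.

Theorem proposition2 (R : realType) (N : nat) (hN : (2 <= N)%N) :
  exists G : {pred affine R N},
    [/\ group_closed G,
        forall g h : affine R N, g \in G -> h \in G -> (g * h = h * g)%g,
        forall g : affine R N, g \in G ->
          g @` cayley_hypersurface R N = cayley_hypersurface R N
      & forall x y : 'cV[R]_N,
          cayley_hypersurface R N x -> cayley_hypersurface R N y ->
          exists g : affine R N, g \in G /\ g x = y].
Proof.
(* The kernel is closed under quotients: z is y divided by x. *)
have transS z x y : translation z x = y -> cayley_hypersurface R N x ->
    cayley_hypersurface R N y -> cayley_hypersurface R N z.
  by rewrite /cayley_hypersurface /= => <- x0; rewrite cayley_translation x0 addr0.
have sum0 x y : cayley_hypersurface R N x -> cayley_hypersurface R N y ->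
    cayley_hypersurface R N (translation x y).
  by rewrite /cayley_hypersurface /= cayley_translation => -> ->; rewrite addr0.
have zeroS : cayley_hypersurface R N 0.
  (* [cayley_poly 0] equals its own double. *)
  have := cayley_translation (0 : 'cV[R]_N) 0.
  by rewrite translation_at0 -{1}[cayley_poly 0]addr0 => /addrI.
exists (@cayley_group R N); split.
- split; first by apply/cayley_groupP; exists 0; rewrite ?translation0.
  move=> _ _ /cayley_groupP[x xS ->] /cayley_groupP[y yS ->].
  (* The quotient of the two translations is the translation by z, the quotient of x by y. *)
  have [z zy] := translation_trans y x; apply/cayley_groupP; exists z.
    exact: transS zy yS xS.
  by rewrite -zy -translationM mulgK.
- move=> _ _ /cayley_groupP[x _ ->] /cayley_groupP[y _ ->].
  by rewrite !translationM translationC.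
- move=> _ /cayley_groupP[x xS ->]; apply/seteqP; split=> [_ [y yS <-]|y yS].
    exact: sum0.
  (* The preimage of y is its quotient by x. *)
  have [z zx] := translation_trans x y; exists z; last by rewrite translationC.
  exact: transS zx xS yS.
- move=> x y xS yS; have [z zx] := translation_trans x y.
  exists (translation z); split=> //; apply/cayley_groupP; exists z => //.
  exact: transS zx xS yS.
Qed.
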